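(* Let $B(w)=\sum_{n\ge1}B_n\frac{w^n}{n!}\in\mathbb{C}[[w]]$ with $B_1\ne0$. For each $m \geq -1$, the generalized attached umbral shift $\mathcal{D}_{B}(m):\mathbb{C}[x] \rightarrow \mathbb{C}[x]$ is the unique linear map satisfying $$\mathcal{D}_{B}(m)e^{xB(w)}=\left(w^{m+1}\frac{\partial}{\partial w}+\frac{m+1}{2}w^{m}\right)e^{xB(w)}.$$
   Context: Linear operators on $\mathbb{C}[x]$ act on elements of $\mathbb{C}[x][[w]]$, such as $e^{xB(w)}=\sum_{n\ge0}x^nB(w)^n/n!$, coefficientwise in powers of $w$. For $m=-1$ the term $\frac{m+1}{2}w^m$ is $0$. $y,x_1,x_2,\dots$ are commuting formal variables. On $y\mathbb{C}[x_1,x_2,x_3,\dots]$ define operators $h(n)$, $n\in\mathbb{Z}$: $h(n)=\frac{1}{(-n-1)!}x_{-n}$ (multiplication) for $n<0$; $h(n)=n!\frac{\partial}{\partial x_n}$ for $n>0$; $h(0)=y\frac{\partial}{\partial y}$ (the identity operator on this space). Set $$L(n)=\frac12\sum_{k\in\mathbb{Z}}h(n-k)h(k)\quad(n\ne0),\qquad L(0)=\frac12\sum_{k\in\mathbb{Z}}h(-|k|)h(|k|),$$ which form a representation of the Virasoro algebra of central charge $1$: $[L(m),L(n)]=(m-n)L(m+n)+\frac1{12}(m^3-m)\delta_{m+n,0}$. $\phi_B:y\mathbb{C}[x_1,x_2,\dots]\to\mathbb{C}[x]$ is the substitution map (restriction of an algebra homomorphism) with $x_j\mapsto B_jx$ ($j\ge1$)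 and $y\mapsto1$. The polynomial $\phi_B(L(-1)^ny)$ has degree exactly $n$. For $m\ge-1$, the generalized attached umbral shift $\mathcal{D}_B(m)$ is defined as the unique linear map $\mathbb{C}[x]\to\mathbb{C}[x]$ satisfying $\mathcal{D}_{B}(m) \circ \phi_{B} \circ L(-1)^{n}y=\phi_{B} \circ L(m)L(-1)^{n}y$ for all $n\ge0$. *)

(* Defs.v *)
From mathcomp Require Import all_boot all_order all_algebra finmap.
From mathcomp Require Import monalg.
From mathcomp Require Import complex.
From mathcomp Require Import boolp classical_sets fsbigop reals.

Set Implicit Arguments.
Unset Strict Implicit.
Unset Printing Implicit Defensive.

Import GRing.Theory.
Local Open Scope ring_scope.

(* C[y, x_1, x_2, ...]: the variable of index 0 is y, that of index j >= 1
   is x_j. The operators below are defined on this whole polynomial ring; they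
   preserve the subspace y C[x_1, x_2, ...], on which y d/dy is the identity,
   and are only ever applied to elements of it, as everything is generated
   from y. *)
Notation fock C := {malg C[{cmonom nat}]}.

Definition fock_var (C : fieldType) (i : nat) : fock C := << ucm i >>.

Definition fock_y (C : fieldType) : fock C := fock_var C 0.

(* The truncated division by the variable of index i is only relevant for
   monomials with a positive exponent mu i. *)
Definition fock_deriv (C : fieldType) (i : nat) (p : fock C) : fock C :=
  \sum_(mu <- msupp p) << p@_mu *+ mu i *g divcm mu (ucm i) >>.

(* Negz k is the integer n = - (k + 1), for which (- n - 1)! = k! *)
Definition heis (C : fieldType) (n : int) (p : fock C) : fock C :=
  match n with
  | Posz 0 => fock_y C * fock_deriv 0 p
  | Posz k => (k`!)%:R *: fock_deriv k p
  | Negz k => ((k`!)%:R^-1 : C) *: (fock_var C k.+1 * p)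
  end.

(* The sums over the integers are sums of families all but finitely many
   members of which vanish. *)
Definition virasoro (C : fieldType) (n : int) (p : fock C) : fock C :=
  (2%:R^-1 : C) *:
  (if n == 0 then
     \sum_(k \in [set: int]) heis (- `|k|) (heis `|k| p)
   else
     \sum_(k \in [set: int]) heis (n - k) (heis k p)).

Definition virasoro_iter (C : fieldType) (n : nat) : fock C :=
  iter n (virasoro (-1)) (fock_y C).

(* A sequence (B_n)_{n >= 1} is a function B : nat -> C whose value at 0 is
   never used. *)
Definition umbral_var (C : fieldType) (B : nat -> C) (i : nat) : {poly C} :=
  if i is 0 then 1 else B i *: 'X.

(* Restricted to y C[x_1, x_2, ...], this is the map phi_B. *)
Definition umbral_subst (C : fieldType) (B : nat -> C) (p : fock C) :
    {poly C} :=
  mmap polyC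
    (fun mu : {cmonom nat} => \prod_(i <- finsupp mu) umbral_var B i ^+ mu i) p.

Definition unique_linear_map (C : fieldType)
    (P : ({poly C} -> {poly C}) -> Prop) (D : {linear {poly C} -> {poly C}}) :=
  P D /\ forall D' : {linear {poly C} -> {poly C}}, P D' -> D' =1 D.

Definition attached_shift_eq (C : fieldType) (B : nat -> C) (m : int)
    (D : {poly C} -> {poly C}) : Prop :=
  forall n : nat,
    D (umbral_subst B (virasoro_iter C n)) =
    umbral_subst B (virasoro m (virasoro_iter C n)).

Definition generalized_attached_umbral_shift (C : fieldType) (B : nat -> C)
    (m : int) (D : {linear {poly C} -> {poly C}}) : Prop :=
  unique_linear_map (attached_shift_eq B m) D.

(* Formal power series in w over V are their coefficient sequences nat -> V. *)
Definition fps_one (V : nzRingType) : nat -> V := fun k => (k == 0)%:R.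

Definition fps_mul (V : nzRingType) (f g : nat -> V) : nat -> V :=
  fun k => \sum_(i < k.+1) f i * g (k - i)%N.

Definition fps_pow (V : nzRingType) (f : nat -> V) (n : nat) : nat -> V :=
  iter n (fps_mul f) (fps_one V).

Definition fps_deriv (V : zmodType) (f : nat -> V) : nat -> V :=
  fun k => f k.+1 *+ k.+1.

(* multiplication by w ^ j *)
Definition fps_shift (V : zmodType) (j : nat) (f : nat -> V) : nat -> V :=
  fun k => if (j <= k)%N then f (k - j)%N else 0.

Definition umbral_series (C : fieldType) (B : nat -> C) : nat -> C :=
  fun n => if n is 0 then 0 else B n / (n`!)%:R.

(* e ^ (x B(w)) = sum_n x ^ n B(w) ^ n / n!; as B(w) has no constant term, the
   coefficient of w ^ k in B(w) ^ n vanishes for n > k. *)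
Definition exp_xB (C : fieldType) (B : nat -> C) : nat -> {poly C} :=
  fun k =>
    \sum_(n \in [set: nat])
      ((fps_pow (umbral_series B) n k / (n`!)%:R) *: 'X^n : {poly C}).

(* To be used for m >= -1, so that the natural number `|m + 1| is m + 1. The
   natural number `|m| is m when m >= 0, and for m = -1 the last term is 0. *)
Definition exp_shift_eq (C : fieldType) (B : nat -> C) (m : int)
    (D : {poly C} -> {poly C}) : Prop :=
  forall k : nat,
    D (exp_xB B k) =
    fps_shift `|(m + 1)%R|%N (fps_deriv (exp_xB B)) k
    + ((m + 1)%:~R / 2%:R : C) *: fps_shift `|m|%N (exp_xB B) k.

(* Main.v *)
Require Import Defs.
From HB Require Import structures.
From mathcomp Require Import all_boot all_order all_algebra.
From mathcomp Require Import finmap monalg complex.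
From mathcomp Require Import boolp classical_sets fsbigop reals.
From mathcomp Require Import zify ring.

Set Implicit Arguments.
Unset Strict Implicit.
Unset Printing Implicit Defensive.

Import GRing.Theory Num.Theory.
Local Open Scope ring_scope.

(* Write e_n = L(-1)^n y. As L(-1) = sum_(k >= 0) h(-1-k) h(k), induction on n
   gives h(k) e_n = n^_k e_(n-k) for k >= 0 together with the recursion
   e_(n+1) = sum_i C(n, i) x_(i+1) e_(n-i). Summing the same pairs of terms in
   L(m) and using the recursion backwards yields
   L(m) e_n = (n^_(m+1) + (m+1)/2 n^_m) e_(n-m).
   Under phi_B the recursion becomes the differential equation
   d/dw e^(x B(w)) = x B'(w) e^(x B(w)), so phi_B(e_n) is n! times the
   coefficient of w^n in e^(x B(w)), and both conditions on D agree. These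
   coefficients have degree exactly n, hence form a basis of C[x]. *)

(** * Scalings, and multiplication and division of monomials by a variable *)

Lemma malgUZ (K : choiceType) (S : nzRingType) (c x : S) (k : K) :
  c *: << x *g k >> = << c * x *g k >>.
Proof. by apply/malgP => k'; rewrite mcoeffZ !(mcoeffU k) mulrnAr. Qed.

Lemma linear_scale (S : comNzRingType) (U V : lmodType S) (a : S) (f : U -> V) :
  linear f -> linear (fun u => a *: f u).
Proof. by move=> fL c u v; rewrite fL scalerDr !scalerA mulrC. Qed.

Lemma linear_mull (S : nzRingType) (U : lmodType S) (A : algType S) (a : A)
  (f : U -> A) : linear f -> linear (fun u => a * f u).
Proof. by move=> fL c u v; rewrite fL mulrDr scalerAr. Qed.

Lemma mulr_scaleD0 (S : comNzRingType) (A : comAlgType S) (x y p q : A) :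
  y * (0%:R *: p + x * q) = 0%:R *: p + x * (y * q).
Proof. by rewrite !scale0r !add0r mulrCA. Qed.

Lemma scale_scaleD (S : comNzRingType) (A : algType S) (a b : nat) (x p q : A) :
  a%:R *: (b%:R *: p + x * q) = (b * a)%:R *: p + x * (a%:R *: q).
Proof. by rewrite natrM mulrC -scalerA -scalerAr scalerDr. Qed.

Lemma malg_ind (K : choiceType) (G : zmodType) (P : {malg G[K]} -> Prop) :
  P 0 -> (forall p q, P p -> P q -> P (p + q)) ->
  (forall c k, P << c *g k >>) -> forall p, P p.
Proof. by move=> P0 PD PU p; rewrite (monalgE p); apply: big_ind. Qed.

Lemma mulcmK i (mu : {cmonom nat}) : divcm (mulcm (ucm i) mu) (ucm i) = mu.
Proof. by apply/eqP/cmP => k; rewrite divcmE mulcmE addKn. Qed.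

Lemma divcmK i (mu : {cmonom nat}) : mu i != 0%N ->
  mulcm (ucm i) (divcm mu (ucm i)) = mu.
Proof.
move=> mui; apply/eqP/cmP => k; rewrite mulcmE divcmE ucmE.
by case: eqVneq => [<-|_]; rewrite ?subn0 // subnKC // lt0n.
Qed.

Lemma divcm_mulcm_neq i j (mu : {cmonom nat}) : i != j ->
  divcm (mulcm (ucm j) mu) (ucm i) = mulcm (ucm j) (divcm mu (ucm i)).
Proof.
move=> ij; apply/eqP/cmP => k; rewrite divcmE !mulcmE divcmE !ucmE.
have [<-|_] := eqVneq i k; last by rewrite !subn0.
by rewrite eq_sym (negbTE ij) !add0n.
Qed.

(** * Partial derivatives and the operators h(n) on the polynomial ring *)

Section FockDerivation.
Variable C : fieldType.
Implicit Types (p q : fock C) (i j : nat).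

(** Summing over any finite set that contains the support lets polynomials with different supports
    be compared term by term. *)
Lemma fock_derivEw i p (d : {fset {cmonom nat}}) : (msupp p `<=` d)%fset ->
  fock_deriv i p = \sum_(mu <- d) << p@_mu *+ mu i *g divcm mu (ucm i) >>.
Proof.
move=> sub; rewrite /fock_deriv; apply: big_fset_incl => // mu _ muN.
by rewrite mcoeff_outdom // mul0rn monalgU0.
Qed.

Lemma fock_deriv_is_linear i : linear (@fock_deriv C i).
Proof.
move=> c p q.
rewrite (@fock_derivEw _ _ (msupp p `|` msupp q)%fset); last first.
  apply: fsubset_trans (msuppD_le _ _) _.
  by rewrite fsetSU // msuppZ_le.
rewrite (fock_derivEw _ (fsubsetUl (msupp p) (msupp q))).
rewrite (fock_derivEw _ (fsubsetUr (msupp p) (msupp q))).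
rewrite scaler_sumr -big_split /=; apply: eq_bigr => mu _.
rewrite mcoeffD mcoeffZ mulrnDl monalgUD; congr (_ + _).
by rewrite malgUZ mulrnAr.
Qed.

HB.instance Definition _ i :=
  GRing.isLinear.Build C (fock C) (fock C) _ (@fock_deriv C i)
    (fock_deriv_is_linear i).

Lemma fock_derivD i : {morph @fock_deriv C i : p q / p + q}.
Proof. exact: linearD. Qed.

Lemma fock_derivU i (c : C) (mu : {cmonom nat}) :
  fock_deriv i << c *g mu >> = << c *+ mu i *g divcm mu (ucm i) >>.
Proof.
by rewrite (fock_derivEw _ msuppU_le) big_seq_fset1 mcoeffUU.
Qed.

Lemma fock_varM_U i (c : C) (mu : {cmonom nat}) :
  fock_var C i * << c *g mu >> = << c *g mulcm (ucm i) mu >>.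
Proof. by rewrite malgM_def /fock_var fgmulUU mul1r. Qed.

Lemma fock_deriv_var i j : fock_deriv i (fock_var C j) = (i == j)%:R.
Proof.
rewrite fock_derivU ucmE eq_sym; case: eqVneq => [->|_]; last first.
  by rewrite mulr0n monalgU0.
have -> : divcm (ucm j) (ucm j) = onecm nat.
  by apply/eqP/cmP => k; rewrite divcmE subnn onecmE.
by [].
Qed.

(** This is the Leibniz rule for a product with one variable; by additivity it reduces to monomials,
    where exponents are compared. *)
Lemma fock_deriv_varM i j p :
  fock_deriv i (fock_var C j * p) =
  (i == j)%:R *: p + fock_var C j * fock_deriv i p.
Proof.
elim/malg_ind: p => [|p q IHp IHq|c mu].
- by rewrite mulr0 !linear0 mulr0 addr0.
- rewrite mulrDr !fock_derivD.
  apply: etrans (congr2 +%R IHp IHq) _.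
  rewrite mulrDr.
  rewrite scalerDr.
  exact: addrACA.
apply: etrans (congr1 (fock_deriv i) (fock_varM_U j c mu)) _.
apply: etrans (fock_derivU i c _) _.
apply: etrans (congr1 (fun q => _ *: _ + fock_var C j * q)
  (esym (fock_derivU i c mu))).
apply: etrans (congr1 (fun q => _ *: _ + q) (esym (fock_varM_U j _ _))).
rewrite mulcmE ucmE eq_sym.
have [<-|ij] := eqVneq i j; last first.
  by rewrite scale0r !add0r add0n divcm_mulcm_neq.
rewrite mulcmK.
(* If the exponent is 0, the truncated division cannot be undone, but the coefficient [c *+ mu i] of
   that term vanishes. *)
have [->|mu0] := eqVneq (mu i) 0%N.
  by rewrite addn0 mulr0n monalgU0 addr0 scale1r.
rewrite divcmK // malgUZ mul1r.
apply: etrans (monalgUD _ _ _).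
by rewrite -mulrS.
Qed.

Lemma heis_is_linear k : linear (@heis C k).
Proof.
case: k => [[|k]|k].
- exact: linear_mull (@fock_deriv_is_linear 0).
- exact: linear_scale (@fock_deriv_is_linear k.+1).
- exact: linear_scale (@linear_mull _ _ _ _ id _).
Qed.

HB.instance Definition _ k :=
  GRing.isLinear.Build C (fock C) (fock C) _ (@heis C k) (heis_is_linear k).

(** For i > 0 this is the Leibniz rule multiplied by i!. For i = 0 the commutator is zero, since
    index 0 is reserved for y and differs from every [j.+1]. *)
Lemma heis_pos_varM (i j : nat) p :
  heis (Posz i) (fock_var C j.+1 * p) =
  ((i == j.+1) * i`!)%:R *: p + fock_var C j.+1 * heis (Posz i) p.
Proof.
case: i => [|i].
  apply: etrans (congr1 ( *%R (fock_y C)) (fock_deriv_varM 0 j.+1 p)) _.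
  exact: mulr_scaleD0.
apply: etrans (congr1 ( *:%R i.+1`!%:R) (fock_deriv_varM i.+1 j.+1 p)) _.
exact: scale_scaleD.
Qed.

Lemma heis_pos_y (i : nat) :
  heis (Posz i) (fock_y C) = (i == 0%N)%:R *: fock_y C.
Proof.
case: i => [|i].
  apply: etrans (congr1 ( *%R (fock_y C)) (fock_deriv_var 0 0)) _.
  by rewrite mulr1 scale1r.
apply: etrans (congr1 ( *:%R i.+1`!%:R) (fock_deriv_var i.+1 0)) _.
by rewrite scaler0 scale0r.
Qed.

End FockDerivation.

(** * Finite-support sums over the integers, and falling factorials *)

Lemma fsum_int (V : zmodType) (f : int -> V) (a b : nat) :
  (forall i, (a <= i)%N -> f (Posz i) = 0) ->
  (forall i, (b <= i)%N -> f (Negz i) = 0) ->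
  \sum_(k \in [set: int]) f k =
  \sum_(i < a) f (Posz i) + \sum_(i < b) f (Negz i).
Proof.
move=> fa fb.
pose r := map Posz (iota 0 a) ++ map Negz (iota 0 b).
have r_uniq : uniq r.
  rewrite cat_uniq !map_inj_uniq ?iota_uniq /= ?andbT; try by move=> ? ? [].
  by apply/hasPn => _ /mapP[i _ ->]; apply/negP => /mapP[].
rewrite (@fsbigE _ _ _ _ _ r f r_uniq) //; last first.
  move=> [i|i] _ ir; [apply: fa | apply: fb]; rewrite leqNgt;
    apply: contra ir => lti; rewrite mem_cat map_f ?orbT //;
    by rewrite mem_iota add0n.
rewrite big_mkcond /=; under eq_bigr do rewrite in_setT.
rewrite big_cat !big_map /=.
by rewrite -{1}(subn0 a) -{1}(subn0 b) !(big_mkord xpredT).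
Qed.

Lemma ffact_add n a b : (n ^_ (a + b) = n ^_ a * (n - a) ^_ b)%N.
Proof.
elim: a => [|a IHa] in n *; first by rewrite ffactn0 mul1n subn0.
case: n => [|n]; first by rewrite addSn !ffact0n.
by rewrite addSn !ffactSS IHa subSS mulnA.
Qed.

Lemma ffact_Sn n k : (n.+1 ^_ k.+1 = n ^_ k.+1 + k.+1 * n ^_ k)%N.
Proof.
rewrite ffactSS ffactnSr mulnC [(k.+1 * _)%N]mulnC -mulnDr.
have [kn|nk] := leqP k n; last by rewrite ffact_small.
by congr (_ * _)%N; rewrite addnS subnK.
Qed.

(** * The Virasoro operators on L(-1)^n y, derived from three relations for h *)

Section VirasoroAction.
Variables (C : numFieldType) (A : comAlgType C).
Variables (h : int -> {linear A -> A}) (x : nat -> A) (y : A).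
Hypothesis h_neg : forall j p, h (Negz j) p = (j`!)%:R^-1 *: (x j * p).
Hypothesis h_pos_mull : forall (i j : nat) p,
  h i (x j * p) = ((i == j.+1) * i`!)%:R *: p + x j * h i p.
Hypothesis h_pos_y : forall i : nat, h i y = (i == 0%N)%:R *: y.

(** The body copies that of [virasoro], with an abstract family [h]; instantiated at [heis], it is
    convertible to [virasoro], and [e] to [virasoro_iter]. *)
Let vir (n : int) (p : A) : A :=
  (2%:R^-1 : C) *:
  (if n == 0 then
     \sum_(k \in [set: int]) h (- `|k|) (h `|k| p)
   else
     \sum_(k \in [set: int]) h (n - k) (h k p)).

Let e n := iter n (vir (-1)) y.

Lemma annihilation_creationC (i j : nat) p : i != j.+1 ->
  h i (h (Negz j) p) = h (Negz j) (h i p).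
Proof.
by move=> ij; rewrite !h_neg linearZ h_pos_mull (negbTE ij) scale0r add0r.
Qed.

(* The terms k < 0 and k >= m + 1 of the sum over k agree in pairs. *)
Lemma virasoro_normal_order (M N : nat) p :
  (forall k, (N <= k)%N -> h (Posz k) p = 0) ->
  vir (M%:Z - 1) p =
  2%:R^-1 *: (\sum_(i < M) h (M.-1 - i)%N (h i p)) +
  \sum_(j < N) h (Negz j) (h (M + j)%N p).
Proof.
move=> hp0; rewrite /vir.
(* The summand [f] stays abstract so that one computation serves both definitions of L(n), the one
   for n = 0 and the one for n != 0. *)
have sumE (f : int -> A) :
    (forall i : nat, (i < M)%N -> f i = h (M.-1 - i)%N (h i p)) ->
    (forall j, f (M + j)%N = h (Negz j) (h (M + j)%N p)) ->
    (forall j, f (Negz j) = h (Negz j) (h (M + j)%N p)) ->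
    2%:R^-1 *: (\sum_(k \in [set: int]) f k) =
    2%:R^-1 *: (\sum_(i < M) h (M.-1 - i)%N (h i p)) +
    \sum_(j < N) h (Negz j) (h (M + j)%N p).
  move=> f_lt f_ge f_neg.
  rewrite (@fsum_int _ _ (M + N) N); last 2 first.
  - move=> i iM; rewrite -(subnKC (leq_trans (leq_addr _ _) iM)) f_ge.
    by rewrite subnKC ?(leq_trans _ iM) ?leq_addr // hp0 ?linear0 //; lia.
  - by move=> i Ni; rewrite f_neg hp0 ?linear0 //; lia.
  rewrite big_split_ord /= -addrA scalerDr; congr (_ *: _ + _).
    by apply: eq_bigr => i _; exact: f_lt.
  rewrite (eq_bigr _ (fun j _ => f_ge (nat_of_ord j))).
  rewrite (eq_bigr _ (fun j _ => f_neg (nat_of_ord j))).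
  (* The paired terms occur twice, which cancels the factor 1/2. *)
  by rewrite -mulr2n -scaler_nat scalerA mulVf ?scale1r // pnatr_eq0.
(* M = 1 is L(0), whose summands are normally ordered by definition. *)
have [M1|M1] := eqVneq M 1%N.
  rewrite M1 subrr eqxx; rewrite M1 in sumE; apply: sumE.
  - by case.
  - by move=> j; rewrite add1n.
  - by move=> j; rewrite add1n.
rewrite ifF; last by apply/negbTE; lia.
apply: sumE => [i iM|j|j].
- by congr (h _ _); lia.
- by congr (h _ _); lia.
(* For negative k the annihilation operator stands on the left; it commutes past h(-1-j) because M +
   j differs from j + 1. *)
- have -> : M%:Z - 1 - Negz j = (M + j)%N by lia.
  by rewrite annihilation_creationC; last by apply/eqP; lia.
Qed.

Lemma creation_scale j n (c : nat) p : (c = j`! * n)%N ->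
  h (Negz j) (c%:R *: p) = n%:R *: (x j * p).
Proof.
move=> ->; rewrite h_neg -scalerAr scalerA natrM mulKf //.
by rewrite pnatr_eq0 -lt0n fact_gt0.
Qed.

(** In L(-1), the case M = 0 of the normal ordering, only the paired terms remain, and n^_i / i! =
    C(n, i). The action of h on [e n] is a premise because its proof by induction calls on this
    recursion. The bound [N] is free so that sums of different lengths can be matched. *)
Lemma virasoro_iter_succ n N : (n < N)%N ->
  (forall k : nat, h k (e n) = (n ^_ k)%:R *: e (n - k)) ->
  e n.+1 = \sum_(i < N) 'C(n, i)%:R *: (x i * e (n - i)).
Proof.
move=> nN he.
have -> : e n.+1 = vir (0%:Z - 1) (e n) by [].
rewrite (@virasoro_normal_order 0 N); last first.
  by move=> k Nk; rewrite he ffact_small ?scale0r //; lia.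
rewrite big_ord0 scaler0 add0r; apply: eq_bigr => i _.
rewrite add0n he (@creation_scale _ 'C(n, i)) //.
by rewrite mulnC bin_ffact.
Qed.

(** Strong induction, applying h(k) to the recursion for e_(n+1). For k > 0 the commutator acts only
    at i = k - 1 and gives C(n, k-1) k! = k n^_(k-1); the other terms reassemble, by the recursion
    for e_(n-k+1), to n^_k. Their sum is (n+1)^_k. *)
Lemma annihilation_virasoro_iter n (k : nat) :
  h k (e n) = (n ^_ k)%:R *: e (n - k).
Proof.
elim/ltn_ind: n k => -[|n] IHn k.
  by rewrite ffact0n sub0n; exact: h_pos_y.
have rec m N : (m <= n)%N -> (m < N)%N ->
    e m.+1 = \sum_(i < N) 'C(m, i)%:R *: (x i * e (m - i)).
  by move=> mn mN; apply: virasoro_iter_succ => // l; exact: IHn.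
rewrite (rec n n.+1) // linear_sum /=.
have -> : \sum_(i < n.+1) h k ('C(n, i)%:R *: (x i * e (n - i))) =
    \sum_(i < n.+1) ('C(n, i) * ((k == i.+1) * k`!))%:R *: e (n - i) +
    (n ^_ k)%:R *: \sum_(i < n.+1) 'C(n - k, i)%:R *: (x i * e (n - k - i)).
  rewrite scaler_sumr -big_split /=; apply: eq_bigr => i _.
  rewrite linearZ /= h_pos_mull scalerDr scalerA -natrM; congr (_ + _).
  have -> : h k (e (n - i)) = ((n - i) ^_ k)%:R *: e (n - i - k).
    by apply: IHn; lia.
  rewrite -scalerAr !scalerA -!natrM subnAC; congr (_%:R *: _).
  (* After multiplication by i!, both sides equal n^_(i+k). *)
  apply/eqP; rewrite -(eqn_pmul2r (fact_gt0 i)) mulnAC bin_ffact -ffact_add.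
  by rewrite -mulnA bin_ffact -ffact_add addnC.
have -> : (n ^_ k)%:R *:
    \sum_(i < n.+1) 'C(n - k, i)%:R *: (x i * e (n - k - i)) =
    (n ^_ k)%:R *: e (n.+1 - k).
  (* When k > n the truncated index [n - k] is wrong, but n^_k is 0. *)
  have [kn|nk] := leqP k n; last by rewrite ffact_small // !scale0r.
  by rewrite -rec ?subSn //; lia.
case: k => [|k].
  rewrite !ffactn0 big1 ?add0r // => i _.
  by rewrite mul0n muln0 scale0r.
rewrite ffact_Sn natrD scalerDl addrC subSS; congr (_ + _).
have [kn|nk] := leqP k n.
  rewrite (bigD1 (Ordinal (kn : k < n.+1)%N)) //= eqxx mul1n.
  rewrite big1 ?addr0; last first.
    move=> i ik; rewrite eqSS; case: eqP => [ki|_].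
      by case/eqP: ik; apply: val_inj.
    by rewrite mul0n muln0 scale0r.
  by rewrite factS mulnCA bin_ffact.
rewrite ffact_small // muln0 scale0r big1 // => i _.
rewrite eqSS; case: eqP => [ki|_]; last by rewrite mul0n muln0 scale0r.
by have := ltn_ord i; lia.
Qed.

Lemma virasoro_iter_rec n N : (n < N)%N ->
  e n.+1 = \sum_(i < N) 'C(n, i)%:R *: (x i * e (n - i)).
Proof.
move=> nN; apply: virasoro_iter_succ => // k.
exact: annihilation_virasoro_iter.
Qed.

(** With m = M - 1, the paired terms sum to the recursion for e_(n-M+1), and the M middle terms give
    the summand with M/2. When M > n + 1 both falling factorials vanish, so the truncated index does
    no harm. *)
Lemma virasoro_virasoro_iter M n :
  vir (M%:Z - 1) (e n) =
  ((n ^_ M)%:R + M%:R / 2%:R * (n ^_ M.-1)%:R) *: e (n.+1 - M).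
Proof.
rewrite (@virasoro_normal_order M n.+1); last first.
  by move=> k nk; rewrite annihilation_virasoro_iter ffact_small ?scale0r.
rewrite addrC scalerDl; congr (_ + _).
  rewrite (eq_bigr (fun j : 'I_n.+1 =>
      (n ^_ M)%:R *: ('C(n - M, j)%:R *: (x j * e (n - M - j))))); last first.
    move=> j _; rewrite annihilation_virasoro_iter.
    rewrite (@creation_scale _ (n ^_ M * 'C(n - M, j))).
      by rewrite natrM scalerA subnDA.
    by rewrite mulnCA mulnC [(j`! * _)%N]mulnC bin_ffact mulnC ffact_add.
  rewrite -scaler_sumr -virasoro_iter_rec ?ltnS ?leq_subr //.
  have [Mn|nM] := leqP M n; first by rewrite subSn.
  by rewrite ffact_small // !scale0r.
(* The middle terms do not depend on i, since n^_i (n-i)^_(M-1-i) = n^_(M-1). *)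
rewrite (eq_bigr (fun=> (n ^_ M.-1)%:R *: e (n.+1 - M))); last first.
  move=> i _; rewrite annihilation_virasoro_iter linearZ /=.
  have iM := ltn_ord i.
  rewrite annihilation_virasoro_iter scalerA -natrM -ffact_add.
  rewrite subnKC; last by lia.
  by congr (_ *: e _); lia.
rewrite sumr_const card_ord -scaler_nat !scalerA.
by congr (_ *: _); rewrite [_ / _]mulrC mulrA.
Qed.

End VirasoroAction.

(** * Powers of formal power series *)

Section FpsPow.
Variable V : nzRingType.
Implicit Types (f : nat -> V) (P : {poly V}).

Lemma fps_powS f n k :
  fps_pow f n.+1 k = \sum_(i < k.+1) f i * fps_pow f n (k - i).
Proof. by []. Qed.

(** Coefficients up to K of a power depend only on those of the base up to K, so identities can be
    transferred from polynomials. *)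
Lemma fps_pow_poly f P K : (forall k, (k <= K)%N -> P`_k = f k) ->
  forall n k, (k <= K)%N -> fps_pow f n k = (P ^+ n)`_k.
Proof.
move=> Pf; elim=> [|n IHn] k kK; first by rewrite expr0 coef1.
rewrite fps_powS exprS coefM; apply: eq_bigr => i _.
by have ik := ltn_ord i; rewrite Pf -?IHn //; lia.
Qed.

Lemma fps_pow_lt f n k : f 0 = 0 -> (k < n)%N -> fps_pow f n k = 0.
Proof.
move=> f0; elim: n k => [//|n IHn] k kn.
rewrite fps_powS big1 // => -[[|i] ik] _ /=; first by rewrite f0 mul0r.
by rewrite IHn ?mulr0 //; lia.
Qed.

Lemma fps_pow_diag f n : f 0 = 0 -> fps_pow f n n = f 1%N ^+ n.
Proof.
move=> f0; elim: n => [//|n IHn].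
rewrite fps_powS !big_ord_recl /= f0 mul0r add0r subSS subn0.
rewrite IHn big1 ?addr0 -?exprS // => i _.
by rewrite fps_pow_lt ?mulr0 //= /bump /=; have := ltn_ord i; lia.
Qed.

End FpsPow.

(** This is the coefficient of w^k in (f^(n+1))' = (n+1) f' f^n, read off from a truncation of f. *)
Lemma fps_pow_deriv (V : comNzRingType) (f : nat -> V) n k :
  fps_pow f n.+1 k.+1 *+ k.+1 =
  (\sum_(i < k.+1) f i.+1 *+ i.+1 * fps_pow f n (k - i)) *+ n.+1.
Proof.
pose P := \poly_(i < k.+2) f i.
have Pf i : (i <= k.+1)%N -> P`_i = f i by rewrite coef_poly ltnS => ->.
rewrite (fps_pow_poly Pf) // -coef_deriv deriv_exp coefMn coefM.
congr (_ *+ _); apply: eq_bigr => i _; have ik := ltn_ord i.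
by rewrite coef_deriv Pf // (fps_pow_poly Pf) //; lia.
Qed.

(** * The coefficients of e^(x B(w)) *)

Section ExpxB.
Variables (C : numFieldType) (B : nat -> C).

Lemma coef_exp_xB k n :
  (exp_xB B k)`_n = fps_pow (umbral_series B) n k / (n`!)%:R.
Proof.
pose c n : C := fps_pow (umbral_series B) n k / (n`!)%:R.
have c0 i : (k < i)%N -> c i = 0 by move=> ki; rewrite /c fps_pow_lt ?mul0r.
have -> : exp_xB B k = \poly_(i < k.+1) c i.
  rewrite poly_def /exp_xB.
  rewrite (@fsbigE _ _ _ _ _ (index_iota 0 k.+1) _ (iota_uniq _ _)) //;
    last first.
    move=> i _; rewrite mem_index_iota ltnS -ltnNge => ki.
    by rewrite [X in X *: _](c0 _ ki) scale0r.
  by rewrite (eq_bigl xpredT) ?big_mkord // => i; rewrite in_setT.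
rewrite coef_poly; case: ltnP => // kn.
by rewrite -/(c n) c0.
Qed.

Lemma exp_xB0 : exp_xB B 0 = 1.
Proof.
apply/polyP => -[|n]; rewrite coef_exp_xB coef1; first by rewrite divr1.
by rewrite fps_pow_lt ?mul0r.
Qed.

(** The coefficient of x^n is B_1^n / n!, and higher ones vanish because B(w) has no constant
    term. *)
Lemma size_exp_xB n : B 1%N != 0 -> size (exp_xB B n) = n.+1.
Proof.
move=> B1; apply/eqP; rewrite eqn_leq; apply/andP; split.
  apply/leq_sizeP => j nj; rewrite coef_exp_xB fps_pow_lt ?mul0r //.
rewrite ltnNge; apply/negP => /leq_sizeP/(_ n (leqnn n))/eqP.
rewrite coef_exp_xB fps_pow_diag // mulf_eq0 expf_eq0 /umbral_series divr1.
by rewrite (negbTE B1) andbF invr_eq0 pnatr_eq0 -leqn0 leqNgt fact_gt0.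
Qed.

(* The coefficient of w ^ k in d/dw e ^ (x B(w)) = x B'(w) e ^ (x B(w)). *)
Lemma exp_xB_rec k :
  exp_xB B k.+1 *+ k.+1 =
  \sum_(i < k.+1) (B i.+1 / (i`!)%:R) *: ('X * exp_xB B (k - i)).
Proof.
apply/polyP => -[|n]; rewrite coefMn coef_exp_xB coef_sum.
  rewrite mul0r mul0rn big1 // => i _.
  by rewrite coefZ coefXM mulr0.
have factV (m : nat) : m.+1%:R / (m.+1)`!%:R = (m`!)%:R^-1 :> C.
  by rewrite factS natrM invfM mulVKf ?pnatr_eq0.
rewrite -mulrnAl fps_pow_deriv -[_ *+ n.+1]mulr_natr -mulrA factV mulr_suml.
apply: eq_bigr => i _; rewrite coefZ coefXM coef_exp_xB mulrA.
congr (_ * _ / _); rewrite /umbral_series -[_ *+ i.+1]mulr_natr.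
by rewrite mulrAC -mulrA factV.
Qed.

End ExpxB.

(** * Linear maps determined by a sequence of polynomials of degree n *)

Section PolyBasis.
Variables (C : fieldType) (F : nat -> {poly C}).
Hypothesis size_F : forall n, size (F n) = n.+1.

Lemma poly_basis_expand n :
  F n = \sum_(i < n) (F n)`_i *: 'X^i + (F n)`_n *: 'X^n.
Proof. by rewrite -[LHS]coefK size_F poly_def big_ord_recr. Qed.

Lemma poly_basis_lead n : (F n)`_n != 0.
Proof.
have := lead_coef_eq0 (F n); rewrite /lead_coef size_F /= => ->.
by rewrite -size_poly_eq0 size_F.
Qed.

(** Induction shows that D and D' agree on X^n: the lower terms of F n agree, and its leading
    coefficient can be cancelled. *)
Lemma poly_basis_uniq (D D' : {linear {poly C} -> {poly C}}) :
  (forall n, D (F n) = D' (F n)) -> D =1 D'.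
Proof.
move=> DF p; rewrite -[p]coefK poly_def !linear_sum /=.
apply: eq_bigr => i _; rewrite !linearZ /=; congr (_ *: _).
elim/ltn_ind: (nat_of_ord i) => {i} n IHn.
have := DF n; rewrite poly_basis_expand !linearD !linear_sum /= !linearZ /=.
rewrite (eq_bigr (fun i : 'I_n => D' ((F n)`_i *: 'X^i))); last first.
  by move=> i _; rewrite !linearZ /= IHn.
by move/addrI/(scalerI (poly_basis_lead n)).
Qed.

Section Extension.
Variable d : nat -> {poly C}.

Definition linear_ext (p : {poly C}) : {poly C} :=
  \sum_(i < size p) p`_i *: d i.

Lemma linear_extEw N (p : {poly C}) :
  (size p <= N)%N -> linear_ext p = \sum_(i < N) p`_i *: d i.
Proof.
move=> pN; rewrite /linear_ext (big_ord_widen _ (fun i => p`_i *: d i) pN).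
rewrite big_mkcond /=; apply: eq_bigr => i _.
by case: ltnP => // /(nth_default 0) ->; rewrite scale0r.
Qed.

Lemma linear_ext_is_linear : linear linear_ext.
Proof.
move=> c p q.
pose N :=
  (size (c *: p + q)%R + size (p : {poly C}) + size (q : {poly C}))%N.
rewrite !(@linear_extEw N); try by rewrite /N; lia.
rewrite scaler_sumr -big_split /=; apply: eq_bigr => i _.
by rewrite coefD coefZ scalerDl scalerA.
Qed.

HB.instance Definition _ :=
  GRing.isLinear.Build C {poly C} {poly C} _ linear_ext linear_ext_is_linear.

End Extension.

Variable G : nat -> {poly C}.

(* The images of 1, X, ..., X ^ (n - 1), solving the triangular system. *)
Fixpoint monom_images n : seq {poly C} :=
  if n is m.+1 then
    rcons (monom_images m)
      (((F m)`_m)^-1 *: (G m - \sum_(i < m) (F m)`_i *: (monom_images m)`_i))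
  else [::].

Lemma size_monom_images n : size (monom_images n) = n.
Proof. by elim: n => //= n IHn; rewrite size_rcons IHn. Qed.

Lemma nth_monom_images n i : (i < n)%N ->
  (monom_images n)`_i = (monom_images i.+1)`_i.
Proof.
elim: n => // n IHn; rewrite ltnS leq_eqVlt => /predU1P[->//|lt_in].
by rewrite -IHn //= nth_rcons size_monom_images lt_in.
Qed.

Lemma poly_basis_ext :
  exists D : {linear {poly C} -> {poly C}}, forall n, D (F n) = G n.
Proof.
pose d i := (monom_images i.+1)`_i; exists (linear_ext d) => n /=.
(* The last entry [d n] was chosen to make the leading term supply exactly what the lower terms lack
   from G n. *)
rewrite (@linear_extEw _ n.+1) ?size_F // big_ord_recr /= {2}/d /=.
rewrite nth_rcons size_monom_images ltnn eqxx scalerA mulfV ?poly_basis_lead //.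
rewrite scale1r addrC -addrA -[RHS]addr0; congr (_ + _).
apply/eqP; rewrite addrC subr_eq0; apply/eqP; apply: eq_bigr => i _.
by rewrite nth_monom_images.
Qed.

End PolyBasis.

(** * The substitution map phi_B as an algebra homomorphism *)

Section UmbralSubst.
Variables (C : fieldType) (B : nat -> C).

(** The monomial function inside [umbral_subst] is named so that its multiplicativity can be
    declared as an instance. *)
Definition umbral_monom (mu : {cmonom nat}) : {poly C} :=
  \prod_(i <- finsupp mu) umbral_var B i ^+ mu i.

Lemma umbral_monomEw (d : {fset nat}) (mu : {cmonom nat}) :
  (finsupp mu `<=` d)%fset ->
  umbral_monom mu = \prod_(i <- d) umbral_var B i ^+ mu i.
Proof.
move=> sub; apply: big_fset_incl => // i _.
by rewrite -cmE_eq0 => /eqP ->; rewrite expr0.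
Qed.

Lemma umbral_monom_morphism : mmorphism umbral_monom.
Proof.
split=> [mu nu|]; last by rewrite /umbral_monom mdom1 big_seq_fset0.
pose d := (finsupp mu `|` finsupp nu)%fset.
rewrite (@umbral_monomEw d) ?mdomD //.
rewrite (umbral_monomEw (fsubsetUl _ _ : _ `<=` d)%fset).
rewrite (umbral_monomEw (fsubsetUr _ _ : _ `<=` d)%fset) -big_split /=.
by apply: eq_bigr => i _; rewrite cmM exprD.
Qed.

HB.instance Definition _ :=
  isMultiplicative.Build {cmonom nat} {poly C} umbral_monom
    umbral_monom_morphism.

Lemma umbral_subst_additive : additive (umbral_subst B).
Proof. exact: (mmap_is_additive (f := @polyC C) (h := umbral_monom)). Qed.

HB.instance Definition _ :=
  GRing.isAdditive.Build (fock C) {poly C} (umbral_subst B)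
    umbral_subst_additive.

Lemma umbral_substM p q :
  umbral_subst B (p * q) = umbral_subst B p * umbral_subst B q.
Proof.
exact: (mmap_is_multiplicative (f := @polyC C) (h := umbral_monom)).1.
Qed.

Lemma umbral_substZ c p : umbral_subst B (c *: p) = c *: umbral_subst B p.
Proof.
apply: etrans (mmapZ (f := @polyC C) (h := umbral_monom) c p) _.
exact: mul_polyC.
Qed.

Lemma umbral_subst_var i : umbral_subst B (fock_var C i) = umbral_var B i.
Proof.
apply: etrans (mmapU (f := @polyC C) (h := umbral_monom) 1 (ucm i)) _.
by rewrite mul1r /umbral_monom mdomU big_seq_fset1 ucmE eqxx expr1.
Qed.

End UmbralSubst.

(** * Comparison of the two conditions on D *)

Section UmbralShift.
Variables (C : numFieldType) (B : nat -> C).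

Let x (j : nat) : fock C := fock_var C j.+1.

Lemma heis_neg j p : heis (Negz j) p = (j`!)%:R^-1 *: (x j * p).
Proof. by []. Qed.

(** Up to the factor n!, phi_B sends the recursion for e_(n+1) to [exp_xB_rec]; the coefficients
    match by n! = C(n, i) i! (n-i)!. *)
Lemma umbral_subst_virasoro_iter n :
  umbral_subst B (virasoro_iter C n) = (n`!)%:R *: exp_xB B n.
Proof.
elim/ltn_ind: n => -[|n] IHn.
  by rewrite exp_xB0 scale1r; exact: umbral_subst_var.
have rec := virasoro_iter_rec heis_neg
  (@heis_pos_varM C) (@heis_pos_y C) (ltnSn n).
apply: etrans (congr1 (umbral_subst B) rec) _.
apply: etrans (raddf_sum (umbral_subst B) _ _ _) _.
rewrite factS mulnC natrM -scalerA [n.+1%:R *: _]scaler_nat.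
rewrite exp_xB_rec scaler_sumr.
apply: eq_bigr => i _.
apply: etrans (umbral_substZ _ _ _) _.
apply: etrans (congr1 ( *:%R _) (umbral_substM _ _ _)) _.
apply: etrans (congr1 (fun q => _ *: (q * _)) (umbral_subst_var _ _)) _.
have ni : (n - i < n.+1)%N by rewrite ltnS leq_subr.
apply: etrans (congr1 (fun q => _ *: (_ * q)) (IHn _ ni)) _.
rewrite /= -scalerAl -scalerAr !scalerA; congr (_ *: _).
have iN : (i <= n)%N by rewrite -ltnS.
have i0 : (i`!)%:R != 0 :> C by rewrite pnatr_eq0 -lt0n fact_gt0.
rewrite -(bin_fact iN) !natrM; field; exact: i0.
Qed.

Lemma umbral_subst_virasoro M n :
  umbral_subst B (virasoro (M%:Z - 1) (virasoro_iter C n)) =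
  (((n ^_ M)%:R + M%:R / 2%:R * (n ^_ M.-1)%:R) * ((n.+1 - M)`!)%:R) *:
    exp_xB B (n.+1 - M).
Proof.
have vir := virasoro_virasoro_iter heis_neg
  (@heis_pos_varM C) (@heis_pos_y C) M n.
apply: etrans (congr1 (umbral_subst B) vir) _.
apply: etrans (umbral_substZ _ _ _) _.
apply: etrans (congr1 ( *:%R _) (umbral_subst_virasoro_iter _)) _.
exact: scalerA.
Qed.

Lemma fact_exp_shift M n :
  (n`!)%:R *: (fps_shift M (fps_deriv (exp_xB B)) n +
    (M%:R / 2%:R) *: fps_shift `|M%:Z - 1|%N (exp_xB B) n) =
  (((n ^_ M)%:R + M%:R / 2%:R * (n ^_ M.-1)%:R) * ((n.+1 - M)`!)%:R) *:
    exp_xB B (n.+1 - M).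
Proof.
rewrite scalerDr mulrDl scalerDl; congr (_ + _).
  rewrite /fps_shift /fps_deriv; case: leqP => [Mn|nM].
    rewrite -scaler_nat scalerA -!natrM subSn //; congr (_%:R *: _).
    by rewrite factS mulnCA ffact_fact // mulnC.
  by rewrite ffact_small // mul0r scale0r scaler0.
(* For M = 0 the absolute value gives a shift by 1, which the factor M/2 = 0 removes. *)
case: M => [|M]; first by rewrite !mul0r !scale0r scaler0.
have -> : `|M.+1%:Z - 1|%N = M by lia.
rewrite subSS /fps_shift /=; case: leqP => [Mn|nM]; last first.
  by rewrite ffact_small // mulr0 mul0r scale0r !scaler0.
by rewrite scalerA -mulrA -natrM ffact_fact // mulrC.
Qed.

(** At each index n, the first condition is the second multiplied by n!, which is invertible. *)
Lemma attached_shift_eqE M (D : {linear {poly C} -> {poly C}}) :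
  attached_shift_eq B (M%:Z - 1) D <-> exp_shift_eq B (M%:Z - 1) D.
Proof.
have n0 n : (n`!)%:R != 0 :> C by rewrite pnatr_eq0 -lt0n fact_gt0.
rewrite /attached_shift_eq /exp_shift_eq subrK absz_nat pmulrn.
split=> DE n; have := DE n;
  rewrite umbral_subst_virasoro umbral_subst_virasoro_iter linearZ
    -fact_exp_shift.
  exact: scalerI.
by move=> ->.
Qed.

End UmbralShift.

Theorem proposition7p2 (R : realType) (B : nat -> R[i]) (hB1 : B 1%N != 0)
    (m : int) (hm : -1 <= m) :
  exists D : {linear {poly R[i]} -> {poly R[i]}},
    generalized_attached_umbral_shift B m D /\
    unique_linear_map (exp_shift_eq B m) D.
Proof.
have sizeF n : size (exp_xB B n) = n.+1 by apply: size_exp_xB.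
have [M ->] : exists M : nat, m = M%:Z - 1.
  by exists `|(m + 1)%R|%N; lia.
(* D is prescribed on the basis of coefficients of e^(x B(w)) by the right-hand side of the
   differential equation. *)
have [D DE] := poly_basis_ext sizeF (fun n =>
  fps_shift `|(M%:Z - 1 + 1)%R|%N (fps_deriv (exp_xB B)) n +
  ((M%:Z - 1 + 1)%:~R / 2%:R : R[i]) *: fps_shift `|M%:Z - 1|%N (exp_xB B) n).
have expU : unique_linear_map (exp_shift_eq B (M%:Z - 1)) D.
  split=> // D' D'E; apply: (poly_basis_uniq sizeF) => n.
  by rewrite D'E DE.
exists D; split=> //; case: expU => _ U; split; first exact/attached_shift_eqE.
by move=> D' /attached_shift_eqE; exact: U.
Qed.
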